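(* For every $\varepsilon>0$ there exists a weighted graph $(\Gamma,\pi)$, with vertex set $G$, such that the essential spectrum of $-\mathcal{L}_{\mathbf 1}$ is empty, but there exists a metric $\rho$ on $G$ adapted to $\mathcal{L}_{\mathbf 1}$ and a vertex $x_0\in G$ such that $$\limsup_{r\to\infty}\frac{1}{r^{1+\varepsilon}}\log V_\rho(x_0,r)<\infty .$$
   Context: Graph: $\Gamma=(G,E)$ is an unoriented, connected, countably infinite, locally finite graph without loops or multiple edges; $x\sim y$ means $\{x,y\}\in E$. Edge weights: $\pi_{xy}=\pi_{yx}\ge 0$ for $x,y\in G$, with $\pi_{xy}>0$ if and only if $\{x,y\}\in E$; $(\Gamma,\pi)$ is then called a weighted graph. Operator: let $\ell^2(G)$ be the real Hilbert space with inner product $\sum_{x\in G}f(x)g(x)$ (all vertex weights equal to $1$). The operator $\mathcal{L}_{\mathbf 1}$ is given by $(\mathcal{L}_{\mathbf 1}f)(x)=\sum_{y\sim x}\pi_{xy}(f(y)-f(x))$ on the domain $\{f\in \ell^2(G):\mathcal{L}_{\mathbf 1}f\in \ell^2(G)\}$; $-\mathcal{L}_{\mathbf 1}$ is a nonnegative self-adjoint, possibly unbounded, operator. Adapted metric: a metric $\rho$ on $G$ is adapted to $\mathcal{L}_{\mathbf 1}$ on $(\Gamma,\pi)$ if $\sum_{y\sim x}\pi_{xy}\rho^2(x,y)\le 1$ for all $x\in G$, and there is $c_\rho>0$ such that $\rho(x,y)\le c_\rho$ whenever $x\sim y$. Volume: $V_\rho(x_0,r)$ is the number of points of $B_\rho(x_0,r)=\{x\in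 G:\rho(x_0,x)\le r\}$. Spectrum: the essential spectrum of $-\mathcal{L}_{\mathbf 1}$ consists of the points of its spectrum that are accumulation points of the spectrum or isolated eigenvalues of infinite multiplicity. *)

(* Defs.v *)
From mathcomp Require Import all_boot all_order all_algebra.
From mathcomp Require Import all_classical all_reals all_analysis.

Set Implicit Arguments.
Unset Strict Implicit.
Unset Printing Implicit Defensive.

Import Order.TTheory GRing.Theory Num.Theory.
Import numFieldNormedType.Exports.

Local Open Scope classical_set_scope.
Local Open Scope ring_scope.

Record weighted_graph (R : realType) := WeightedGraph {
  vertex :> countType ;
  vertex_infinite : infinite_set [set: vertex] ;
  adj : rel vertex ;
  adj_sym : forall x y, adj x y = adj y x ;
  adj_irrefl : forall x, ~~ adj x x ;
  adj_locally_finite : forall x, finite_set [set y | adj x y] ;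
  adj_connected : forall x y, exists p : seq vertex, path adj x p /\ last x p = y ;
  weight : vertex -> vertex -> R ;
  weight_sym : forall x y, weight x y = weight y x ;
  weight_ge0 : forall x y, 0 <= weight x y ;
  weight_gt0 : forall x y, 0 < weight x y <-> adj x y }.

Section ell2.
Variables (R : realType) (G : choiceType).
Implicit Types (f g : G -> R) (D : set (G -> R)) (A : (G -> R) -> (G -> R)).

Definition ell2 : set (G -> R) :=
  [set f | (\esum_(x in [set: G]) ((f x) ^+ 2)%:E < +oo)%E].

(* Only meaningful on [ell2]: [fine] sends a divergent sum to 0. *)
Definition ell2_norm f : R :=
  Num.sqrt (fine (\esum_(x in [set: G]) ((f x) ^+ 2)%:E)).

(* A possibly unbounded operator on ell^2(G) is a domain D together with a map A,
   of which only the restriction to D matters. Spectra are subsets of R, which is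
   no loss for self-adjoint operators: passing to the complexification adds no
   spectral point off the real line and does not change the real ones. *)
Definition resolvent_set D A : set R := [set lam |
  let B := fun f x => A f x - lam * f x in
  set_bij D ell2 B /\
  exists C : R, forall f, D f -> ell2_norm f <= C * ell2_norm (B f)].

Definition spectrum D A : set R := ~` resolvent_set D A.

Definition eigenspace D A (lam : R) : set (G -> R) :=
  [set f | D f /\ forall x, A f x = lam * f x].

Definition linearly_independent n (e : 'I_n -> G -> R) : Prop :=
  forall c : 'I_n -> R,
    (forall x, \sum_(i < n) c i * e i x = 0) -> forall i, c i = 0.

Definition infinite_dimensional (E : set (G -> R)) : Prop :=
  forall n, exists e : 'I_n -> G -> R,
    (forall i, E (e i)) /\ linearly_independent e.

Definition essential_spectrum D A : set R := [set lam |
  spectrum D A lam /\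
  (limit_point (spectrum D A) lam \/
   isolated (spectrum D A) lam /\ infinite_dimensional (eigenspace D A lam))].

End ell2.

Section graph_laplacian.
Variables (R : realType) (Gamma : weighted_graph R).
Implicit Types (f : Gamma -> R) (rho : Gamma -> Gamma -> R).

(* The index 1 refers to the vertex weights, all equal to 1: there is no
   normalization by the total edge weight at x. *)
Definition laplacian1 f : Gamma -> R :=
  fun x => \sum_(y \in [set y | adj x y]) weight x y * (f y - f x).

Definition laplacian1_domain : set (Gamma -> R) :=
  [set f | @ell2 R Gamma f /\ @ell2 R Gamma (laplacian1 f)].

Definition neg_laplacian1 f : Gamma -> R := fun x => - laplacian1 f x.

Definition is_metric rho : Prop :=
  [/\ forall x y, 0 <= rho x y,
      forall x y, rho x y = 0 <-> x = y,
      forall x y, rho x y = rho y x &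
      forall x y z, rho x z <= rho x y + rho y z].

Definition adapted_metric rho : Prop :=
  [/\ is_metric rho,
      forall x, \sum_(y \in [set y | adj x y]) weight x y * rho x y ^+ 2 <= 1 &
      exists2 c : R, 0 < c & forall x y, adj x y -> rho x y <= c].

Definition metric_ball rho (x0 : Gamma) (r : R) : set Gamma :=
  [set x | rho x0 x <= r].

(* Equal to +oo when the ball is infinite. *)
Definition volume rho (x0 : Gamma) (r : R) : \bar R :=
  counting (metric_ball rho x0 r).

End graph_laplacian.

(* Main.v *)
Require Import Defs.
From mathcomp Require Import all_boot all_order all_algebra.
From mathcomp Require Import all_classical all_reals all_analysis.
From mathcomp Require Import ring lra.

(* The graph is the half-line nat. With beta = 1 / (1 + eps), place the vertex n
   at phi(n) = (1 + ln (n + 1))^beta, let rho(m, n) = |phi(m) - phi(n)| and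
   w(n) = 1 / (2 s(n)^2) with s(n) = phi(n + 1) - phi(n); then rho is adapted
   and the ball of radius r about 0 has at most exp((1 + r)^(1 + eps)) points.

   Since (n + 1) s(n) -> 0, w(n) / (n + 1)^2 tends to infinity, so by Hardy's
   inequality the energy controls M times the mass outside a finite set, for
   every M. Let p_lam be the solution of -L f = lam f with f(0) = 1.
   If p_lam is not in ell^2, the Dirichlet problems for -L - lam on [0, n] have
   uniformly bounded solutions, and a limit of these inverts -L - lam; so every
   spectral point is an eigenvalue with eigenspace spanned by p_lam.
   Eigenfunctions with lam in a bounded set keep most of their mass in a fixed
   finite set, p_lam depends continuously on lam there, and eigenfunctions for
   distinct eigenvalues are orthogonal because the sum of the s(n) diverges (rho
   is complete); so eigenvalues do not accumulate. *)

Set Implicit Arguments.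
Unset Strict Implicit.
Unset Printing Implicit Defensive.

Import Order.TTheory GRing.Theory Num.Theory.
Import numFieldNormedType.Exports.

Local Open Scope classical_set_scope.
Local Open Scope ring_scope.

(** * Jacobi operators on the half-line *)

(* -L on the half-line with weight w(n) on the edge {n, n + 1}. *)
Definition jacobi (R : realFieldType) (w f : nat -> R) (n : nat) : R :=
  w n * (f n - f n.+1) + (if n is m.+1 then w m * (f n - f m) else 0).

(* The state at n is the pair (f(n), w(n - 1) (f(n - 1) - f(n))), which turns
   -L f = g + lam f, f(0) = c into a first-order recursion. *)
Fixpoint shoot (R : realFieldType) (w : nat -> R) (lam : R) (g : nat -> R)
    (c : R) (n : nat) : R * R :=
  if n is m.+1 then
    let st := shoot w lam g c m in
    let J := st.2 + (g m + lam * st.1) in (st.1 - J / w m, J)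
  else (c, 0).

Definition solution (R : realFieldType) (w : nat -> R) (lam : R)
    (g : nat -> R) (c : R) (n : nat) : R := (shoot w lam g c n).1.

Definition eigensolution (R : realFieldType) (w : nat -> R) (lam : R) :
  nat -> R := solution w lam (fun _ => 0) 1.

Lemma solutionP (R : realFieldType) (w : nat -> R) (lam : R) (g : nat -> R)
    (c : R) : (forall k, 0 < w k) ->
  forall n, jacobi w (solution w lam g c) n =
    g n + lam * solution w lam g c n.
Proof.
move=> w0 n.
have flux m : w m * (solution w lam g c m - solution w lam g c m.+1) =
    (shoot w lam g c m.+1).2.
  rewrite /solution /= opprB addrCA subrr addr0 mulrC divfK //.
  exact: lt0r_neq0.
have fluxS m : (shoot w lam g c m.+1).2 =
    (shoot w lam g c m).2 + (g m + lam * solution w lam g c m) by [].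
case: n => [|n]; rewrite /jacobi flux fluxS; first by rewrite add0r addr0.
rewrite -[X in w n * X]opprB mulrN flux; ring.
Qed.

Lemma solution_unique (R : realFieldType) (w : nat -> R) (lam : R)
    (g f : nat -> R) : (forall k, 0 < w k) ->
  (forall n, jacobi w f n = g n + lam * f n) ->
  forall n, f n = solution w lam g (f 0%N) n.
Proof.
move=> w0 hf n.
suff: f n = (shoot w lam g (f 0%N) n).1 /\
      w n * (f n - f n.+1) = (shoot w lam g (f 0%N) n.+1).2 by case.
elim: n => [|n [IH1 IH2]].
  by split=> //=; move: (hf 0%N); rewrite /jacobi addr0 add0r.
have e1 : f n.+1 = (shoot w lam g (f 0%N) n.+1).1.
  have -> : (shoot w lam g (f 0%N) n.+1).1 = (shoot w lam g (f 0%N) n).1 -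
      (shoot w lam g (f 0%N) n.+1).2 / w n by [].
  have wn := lt0r_neq0 (w0 n).
  by rewrite -IH2 -IH1; field.
split=> //; move: (hf n.+1); rewrite /jacobi -[X in w n * X]opprB mulrN IH2.
move=> /eqP; rewrite subr_eq => /eqP ->.
have -> : (shoot w lam g (f 0%N) n.+2).2 = (shoot w lam g (f 0%N) n.+1).2 +
    (g n.+1 + lam * (shoot w lam g (f 0%N) n.+1).1) by [].
rewrite -e1; ring.
Qed.

(** The free initial value is the one parameter available later to force a solution to vanish at a
    prescribed vertex. *)
Lemma solution_affine (R : realFieldType) (w : nat -> R) (lam : R)
    (g : nat -> R) (c : R) (n : nat) :
  solution w lam g c n = solution w lam g 0 n + c * eigensolution w lam n.
Proof.
suff: (shoot w lam g c n).1 = (shoot w lam g 0 n).1 +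
    c * (shoot w lam (fun=> 0) 1 n).1 /\
  (shoot w lam g c n).2 = (shoot w lam g 0 n).2 +
    c * (shoot w lam (fun=> 0) 1 n).2 by case.
elim: n => [|n [IH1 IH2]] /=; first by split; rewrite ?add0r ?mulr1 ?mulr0.
by split; rewrite IH1 IH2; ring.
Qed.

(** The recursion is linear in the state and the source, so K can be fixed before g. This gives
    control on a fixed initial segment, uniformly in the source. *)
Lemma solution_bound (R : realFieldType) (w : nat -> R) (lam : R) (n : nat) :
  exists2 K : R, 0 <= K & forall (g : nat -> R) (B : R),
    (forall k, `|g k| <= B) -> `|solution w lam g 0 n| <= K * B.
Proof.
suff [K [K0 hK]] : exists K : R, 0 <= K /\ forall (g : nat -> R) (B : R),
    (forall k, `|g k| <= B) -> `|(shoot w lam g 0 n).1| <= K * B /\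
    `|(shoot w lam g 0 n).2| <= K * B.
  by exists K => // g B /hK [].
elim: n => [|n [K [K0 IH]]].
  by exists 0; split=> // g B _; rewrite /= normr0 mul0r.
exists (K + (K + (1 + `|lam| * K)) / `|w n| + (K + (1 + `|lam| * K))).
have P1 : 0 <= `|lam| * K by rewrite mulr_ge0.
have P2 : 0 <= (K + (1 + `|lam| * K)) / `|w n|.
  by rewrite divr_ge0 //; lra.
split; first by lra.
move=> g B hB.
have [h1 h2] := IH g B hB.
have B0 : 0 <= B by apply: le_trans (hB 0%N).
have hJ : `|(shoot w lam g 0 n).2 + (g n + lam * (shoot w lam g 0 n).1)| <=
    (K + (1 + `|lam| * K)) * B.
  apply: le_trans (ler_normD _ _) _; rewrite mulrDl lerD //.
  apply: le_trans (ler_normD _ _) _; rewrite mulrDl mul1r lerD //.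
  by rewrite normrM -mulrA ler_wpM2l.
rewrite /=; split.
  apply: le_trans (ler_normB _ _) _; rewrite normrM normfV.
  have h3 : `|(shoot w lam g 0 n).2 + (g n + lam * (shoot w lam g 0 n).1)| *
      `|w n|^-1 <= (K + (1 + `|lam| * K)) * B * `|w n|^-1.
    by rewrite ler_wpM2r // invr_ge0.
  have h4 : 0 <= (K + (1 + `|lam| * K)) * B by rewrite mulr_ge0 //; lra.
  by move: (lerD h1 (lerD h3 h4)); set X := (X in X * `|w n|^-1 + _); lra.
by apply: le_trans hJ _; rewrite ler_wpM2r //; lra.
Qed.

Lemma eigenfunctionE (R : realFieldType) (w : nat -> R) (lam : R)
    (f : nat -> R) : (forall k, 0 < w k) ->
  (forall n, jacobi w f n = lam * f n) ->
  forall n, f n = f 0%N * eigensolution w lam n.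
Proof.
move=> w0 hf n.
have hf' k : jacobi w f k = 0 + lam * f k by rewrite hf add0r.
rewrite [LHS](solution_unique w0 hf') solution_affine.
have [K K0 hK] := solution_bound w lam n.
suff -> : solution w lam (fun=> 0) 0 n = 0 by rewrite add0r.
(* Zero source and zero initial value: the case B = 0 of [solution_bound]. *)
apply/eqP; rewrite -normr_le0.
have := hK (fun=> 0) 0; rewrite mulr0; apply=> k.
by rewrite normr0.
Qed.

(** * Energy, mass and Hardy's inequality *)

Definition energy (R : realFieldType) (w f : nat -> R) (n : nat) : R :=
  \sum_(k < n) w k * (f k.+1 - f k) ^+ 2.

Definition mass (R : realFieldType) (f : nat -> R) (n : nat) : R :=
  \sum_(k < n) f k ^+ 2.

Lemma mass_ge0 (R : realFieldType) (f : nat -> R) (n : nat) : 0 <= mass f n.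
Proof. by apply: sumr_ge0 => k _; rewrite sqr_ge0. Qed.

Lemma energy_ge0 (R : realFieldType) (w f : nat -> R) (n : nat) :
  (forall k, 0 < w k) -> 0 <= energy w f n.
Proof.
by move=> w0; apply: sumr_ge0 => k _; rewrite mulr_ge0 ?sqr_ge0 // ltW.
Qed.

Lemma massS (R : realFieldType) (f : nat -> R) (n : nat) :
  mass f n.+1 = mass f n + f n ^+ 2.
Proof. by rewrite /mass big_ord_recr. Qed.

Lemma energyS (R : realFieldType) (w f : nat -> R) (n : nat) :
  energy w f n.+1 = energy w f n + w n * (f n.+1 - f n) ^+ 2.
Proof. by rewrite /energy big_ord_recr. Qed.

Lemma mass_mono (R : realFieldType) (f : nat -> R) (m n : nat) :
  (m <= n)%N -> mass f m <= mass f n.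
Proof.
move=> /subnK <-; elim: (n - m)%N => [|k IH] //.
by rewrite addSn massS (le_trans IH) // lerDl sqr_ge0.
Qed.

Lemma sqr_le_mass (R : realFieldType) (f : nat -> R) (n : nat) (C : R) :
  (forall m, mass f m <= C) -> f n ^+ 2 <= C.
Proof.
by move=> h; apply: le_trans (h n.+1); rewrite massS lerDr mass_ge0.
Qed.

Lemma green_identity (R : realFieldType) (w f : nat -> R) (n : nat) :
  \sum_(k < n.+1) f k * jacobi w f k =
  energy w f n.+1 - w n * f n.+1 * (f n.+1 - f n).
Proof.
elim: n => [|n IH].
  by rewrite /energy !big_ord_recr !big_ord0 /= /jacobi; ring.
by rewrite big_ord_recr IH [energy w f n.+2]energyS /= /jacobi; ring.
Qed.

(** For eigenfunctions p, q with eigenvalues lam, mu the left side is (mu - lam) times their partial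
    inner product, so a small boundary term on the right means near orthogonality. *)
Lemma wronskian_identity (R : realFieldType) (w f g : nat -> R) (n : nat) :
  \sum_(k < n.+1) (f k * jacobi w g k - g k * jacobi w f k) =
  w n * (g n * f n.+1 - f n * g n.+1).
Proof.
elim: n => [|n IH].
  by rewrite !big_ord_recr !big_ord0 /= /jacobi; ring.
by rewrite big_ord_recr IH /= /jacobi; ring.
Qed.

(* Telescoping (k+1) f(k+1)^2 - k f(k)^2 and AM-GM; the term
   (2n + 1/2) f(n)^2 is the boundary contribution. *)
Lemma hardy (R : realFieldType) (w f : nat -> R) (M : R) (N n : nat) :
  0 <= M -> (forall k, 0 < w k) ->
  (forall k, (N <= k)%N -> M * k.+1%:R ^+ 2 <= w k) -> (N <= n)%N ->
  M * (mass f n - mass f N) <=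
  4 * energy w f n + M * (2 * n%:R + 2^-1) * f n ^+ 2.
Proof.
move=> M0 w0 hw /subnK <-; elim: (n - N)%N => [|k IH].
  have b0 : 0 <= 2 * N%:R + 2^-1 :> R by rewrite addr_ge0 ?mulr_ge0 ?invr_ge0.
  rewrite add0n subrr mulr0 addr_ge0 ?(mulr_ge0 _ (energy_ge0 _ _ _)) //.
  by rewrite mulr_ge0 ?sqr_ge0 // mulr_ge0.
rewrite addSn massS energyS.
set m := (k + N)%N in IH *.
have hm : (N <= m)%N by rewrite leq_addl.
move: (hw m hm); rewrite -natr1 => h1.
set x := f m in IH *; set d := f m.+1 - x.
have -> : f m.+1 = x + d by rewrite /d; ring.
have h2 : M * (m%:R + 1) ^+ 2 * d ^+ 2 <= w m * d ^+ 2.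
  by rewrite ler_wpM2r ?sqr_ge0.
(* Completing the square in x: this is exactly the slack of the induction step once 4 w(m) d^2 is
   replaced by 4 M (m + 1)^2 d^2. *)
have h3 : 0 <= M * ((x + (2 * (m%:R + 1) + 2^-1) * d) ^+ 2 + 4^-1 * d ^+ 2).
  by rewrite mulr_ge0 // addr_ge0 ?sqr_ge0 // mulr_ge0 ?sqr_ge0 ?invr_ge0.
have := lerD IH (lerD h3 h2); lra.
Qed.

(** The factor 2 in [weightE] shares the adaptedness bound between the two edges at a vertex.
    [steps_diverge] is completeness of the metric, [step_le] tames the factor n in Hardy's boundary
    term, and [weight_superquadratic] feeds [hardy] for every M. *)
Record admissible (R : realFieldType) (s w : nat -> R) : Prop := Admissible {
  step_gt0 : forall k, 0 < s k ;
  weightE : forall k, w k = (2 * s k ^+ 2)^-1 ;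
  step_le : forall k, k.+1%:R * s k <= 1 ;
  steps_diverge : forall K : R, exists n, K < \sum_(k < n) s k ;
  weight_superquadratic : forall M : R,
    exists N, forall k, (N <= k)%N -> M * k.+1%:R ^+ 2 <= w k }.

Lemma weights_gt0 (R : realFieldType) (s w : nat -> R) :
  admissible s w -> forall k, 0 < w k.
Proof.
move=> hsw k; rewrite (weightE hsw) invr_gt0 mulr_gt0 // exprn_gt0 //.
exact: step_gt0 hsw k.
Qed.

(** Otherwise a(n) > delta s(n) from N on, and the divergence of the sum of s contradicts the bound
    C. This is how boundary terms are made small at some far vertex. *)
Lemma small_index (R : realFieldType) (s w a : nat -> R) (C delta : R)
    (N : nat) : admissible s w ->
  (forall k, 0 <= a k) -> (forall n, \sum_(k < n) a k <= C) -> 0 < delta ->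
  exists2 n, (N <= n)%N & a n <= delta * s n.
Proof.
move=> hsw a0 aC d0; apply: contrapT => hN.
have H n : (N <= n)%N -> delta * s n < a n.
  by move=> leNn; rewrite ltNge; apply/negP => han; apply: hN; exists n.
have s0 k : 0 <= s k by rewrite ltW // (step_gt0 hsw).
have key n : delta * \sum_(k < n) s k <=
    delta * \sum_(k < N) s k + \sum_(k < n) a k.
  elim: n => [|n IH].
    by rewrite !big_ord0 mulr0 addr0 mulr_ge0 ?sumr_ge0 // ltW.
  have [ltnN|leNn] := ltnP n N; last first.
    by rewrite !big_ord_recr /= mulrDr addrA lerD // ltW // H.
  apply: (@le_trans _ _ (delta * \sum_(k < N) s k)); last first.
    by rewrite lerDl sumr_ge0.
  rewrite ler_pM2l // -(subnK ltnN).
  elim: (N - n.+1)%N => [|k IHk]; first by [].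
  by rewrite addSn [X in _ <= X]big_ord_recr /= (le_trans IHk) // lerDl.
have [n hn] := steps_diverge hsw ((delta * \sum_(k < N) s k + C) / delta).
have := key n; have := aC n; move: hn; rewrite ltr_pdivrMr // mulrC.
by lra.
Qed.

(* Since f(m) (f(m+1) - f(m)) <= (f(m+1)^2 - f(m)^2) / 2, the boundary term of
   Green's identity is nonpositive whenever f(m+1)^2 <= f(m)^2, and this happens
   for arbitrarily large m. *)
Lemma energy_bounded (R : realFieldType) (s w f : nat -> R) (lam C : R) :
  admissible s w -> (forall n, jacobi w f n = lam * f n) ->
  (forall n, mass f n <= C) -> forall n, energy w f n <= `|lam| * C.
Proof.
move=> hsw hf fC n.
have w0 := weights_gt0 hsw.
have emono m k : energy w f m <= energy w f (k + m).
  elim: k => [|k IH]; first by [].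
  by rewrite addSn energyS (le_trans IH) // lerDl mulr_ge0 ?sqr_ge0 // ltW.
have base m : f m.+1 ^+ 2 <= f m ^+ 2 -> energy w f m <= `|lam| * C.
  move=> hm.
  have /esym : \sum_(k < m.+1) f k * jacobi w f k = lam * mass f m.+1.
    by rewrite /mass mulr_sumr; apply: eq_bigr => k _; rewrite hf; ring.
  rewrite green_identity energyS => e.
  have h1 : lam * mass f m.+1 <= `|lam| * C.
    rewrite (le_trans (ler_norm _)) // normrM (ger0_norm (mass_ge0 _ _)).
    by rewrite ler_wpM2l.
  have h2 : w m * (f m * (f m.+1 - f m)) <= 0.
    rewrite -oppr_ge0 -mulrN mulr_ge0 ?(ltW (w0 m)) //.
    have := sqr_ge0 (f m.+1 - f m); lra.
  by lra.
suff [m hm] : exists m, f (m + n).+1 ^+ 2 <= f (m + n)%N ^+ 2.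
  by apply: le_trans (base _ hm).
(* Otherwise f^2 increases strictly from n on and stays at least f(n+1)^2 > 0, whereas [small_index]
   gives m > n with f(m)^2 <= s(m) f(n+1)^2 / 2, and s(m) <= 1. *)
apply: contrapT => hN.
have H m : f (m + n)%N ^+ 2 < f (m + n).+1 ^+ 2.
  by rewrite ltNge; apply/negP => hm; apply: hN; exists m.
have H1 m : f n.+1 ^+ 2 <= f (m + n.+1)%N ^+ 2.
  elim: m => [|m IH]; first by [].
  by rewrite (le_trans IH) // addSn addnS -addSn ltW // H.
have e0 : 0 < f n.+1 ^+ 2 by rewrite (le_lt_trans (sqr_ge0 (f n))) // (H 0%N).
have e1 : 0 < f n.+1 ^+ 2 / 2 by rewrite divr_gt0.
have [m leNm] := @small_index _ _ _ (fun k => f k ^+ 2) C _ n.+1 hsw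
  (fun k => sqr_ge0 (f k)) fC e1.
have := H1 (m - n.+1)%N; rewrite subnK // => h1 h2.
have : s m <= 1.
  rewrite (le_trans _ (step_le hsw m)) // ler_peMl ?ler1n //.
  by rewrite ltW // (step_gt0 hsw).
by rewrite -(ler_pM2l e1) => h3; move: h2 => /= h2; lra.
Qed.

(** Gathers every quantity occurring in boundary terms at the edge {n, n + 1}, so that a single use
    of [small_index] controls them all. *)
Definition edge_mass (R : realFieldType) (w p : nat -> R) (n : nat) : R :=
  p n ^+ 2 + p n.+1 ^+ 2 + w n * (p n.+1 - p n) ^+ 2.

Lemma edge_mass_ge0 (R : realFieldType) (w p : nat -> R) (n : nat) :
  (forall k, 0 < w k) -> 0 <= edge_mass w p n.
Proof.
by move=> w0; rewrite !addr_ge0 ?sqr_ge0 // mulr_ge0 ?sqr_ge0 // ltW.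
Qed.

Lemma edge_mass_bounded (R : realFieldType) (s w p : nat -> R) (lam C : R)
    (n : nat) :
  admissible s w -> (forall n, jacobi w p n = lam * p n) ->
  (forall n, mass p n <= C) ->
  \sum_(k < n) edge_mass w p k <= 2 * C + `|lam| * C.
Proof.
move=> hsw hp pC; rewrite /edge_mass !big_split /=.
rewrite lerD ?(energy_bounded hsw hp pC) // mulr_natl mulr2n lerD ?pC //.
apply: le_trans (pC n.+1); rewrite /mass big_ord_recl lerDr sqr_ge0 //.
Qed.

(* Weighted AM-GM, with the weight s(n) chosen so that 2 s(n)^2 w(n) = 1. *)
Lemma flux_bound (R : realFieldType) (s w : nat -> R) (x d delta a : R)
    (n : nat) : admissible s w ->
  x ^+ 2 + w n * d ^+ 2 <= a -> a <= delta * s n ->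
  `|w n * (x * d)| <= delta / 2.
Proof.
move=> hsw ha had; have s0 := step_gt0 hsw n.
have e2 : 0 < 2 * s n ^+ 2 by rewrite mulr_gt0 ?exprn_gt0.
have wE := weightE hsw n.
have h : 2 * s n ^+ 2 * x ^+ 2 + d ^+ 2 <= s n * (2 * s n ^+ 2 * delta).
  have := le_trans ha had; rewrite wE -(ler_pM2l e2) mulrDr mulrA.
  by rewrite mulVKf ?lt0r_neq0 // => ?; lra.
have key : `|x| * `|d| <= s n ^+ 2 * delta.
  rewrite -(ler_pM2l s0); have := sqr_ge0 (s n * `|x| - `|d|).
  have := sqr_ge0 (s n * x); rewrite sqrrB !exprMn !real_normK ?num_real //.
  by lra.
rewrite wE normrM normfV (gtr0_norm e2) mulrC ler_pdivrMr // normrM.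
by lra.
Qed.

(* Eigenfunctions have at least two thirds of their mass on [0, N), so two of
   them that are close there cannot be orthogonal; distinct eigenvalues have
   orthogonal eigenfunctions by the Wronskian identity. *)
Lemma eigenfunctions_apart (R : realFieldType) (s w p q : nat -> R)
    (lam mu L C : R) (N : nat) : admissible s w -> (0 < N)%N ->
  0 < L -> `|lam| <= L -> `|mu| <= L -> lam != mu ->
  (forall k, (N <= k)%N -> 12 * L * k.+1%:R ^+ 2 <= w k) ->
  (forall n, jacobi w p n = lam * p n) -> (forall n, jacobi w q n = mu * q n) ->
  p 0%N = 1 -> q 0%N = 1 ->
  (forall n, mass p n <= C) -> (forall n, mass q n <= C) ->
  1 <= mass (fun k => p k - q k) N.
Proof.
move=> hsw N0 L0 hlam hmu neq hN hp hq p0 q0 pC qC.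
set D := mass _ N; rewrite leNgt; apply/negP => D1.
have w0 := weights_gt0 hsw.
(* For the tail T of an eigenfunction f beyond N, Hardy and Green give 8 L T <= 4 L mass f N + (2 +
   36 L) delta: 2 delta comes from the flux, 36 L delta from Hardy's boundary term. Dividing by 8 L
   produces K. *)
pose K := (2 + 36 * L) / (8 * L).
have K0 : 0 < K by rewrite divr_gt0 //; lra.
have nr : 0 < `|lam - mu| by rewrite normr_gt0 subr_eq0.
pose I := `|lam - mu|^-1.
have I0 : 0 < I by rewrite invr_gt0.
have KI : 0 < K + I by lra.
pose delta := (1 - D) / 4 / (K + I).
have d0 : 0 < delta by rewrite !divr_gt0 //; lra.
have dE : K * delta + I * delta = (1 - D) / 4.
  by rewrite -mulrDl mulrC divfK ?lt0r_neq0.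
have [] := @small_index _ s w (fun k => edge_mass w p k + edge_mass w q k)
  (2 * C + `|lam| * C + (2 * C + `|mu| * C)) delta N hsw _ _ d0.
- by move=> k; rewrite addr_ge0 ?edge_mass_ge0.
- by move=> n; rewrite big_split lerD ?(edge_mass_bounded n hsw hp) //
    (edge_mass_bounded n hsw hq).
move=> n leNn small.
have ep0 := edge_mass_ge0 p n w0; have eq0 := edge_mass_ge0 q n w0.
have tail (f : nat -> R) nu : `|nu| <= L ->
    (forall n, jacobi w f n = nu * f n) -> edge_mass w f n <= delta * s n ->
    mass f n.+1 - mass f N <= mass f N / 2 + K * delta.
  move=> hnu hf hfs.
  have wd0 : 0 <= w n * (f n.+1 - f n) ^+ 2 by rewrite mulr_ge0 ?sqr_ge0 ?ltW.
  have f0 := sqr_ge0 (f n).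
  have := flux_bound (x := f n.+1) (d := f n.+1 - f n) hsw _ hfs.
  rewrite /edge_mass => /(_ _)/wrap[|hflux]; first by lra.
  have /esym : \sum_(k < n.+1) f k * jacobi w f k = nu * mass f n.+1.
    by rewrite /mass mulr_sumr; apply: eq_bigr => k _; rewrite hf; ring.
  rewrite green_identity => hE.
  have h1 : nu * mass f n.+1 <= L * mass f n.+1.
    by rewrite ler_wpM2r ?mass_ge0 // (le_trans (ler_norm _)).
  have h2 := le_trans (ler_norm _) hflux.
  have L12 : 0 <= 12 * L by lra.
  have := hardy f L12 w0 hN (leqW leNn).
  (* The growing factor is at most 3 (n + 1), and (n + 1) s(n) <= 1 absorbs it. *)
  have h3 : (2 * n.+1%:R + 2^-1) * f n.+1 ^+ 2 <= 3 * delta.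
    have h4 : f n.+1 ^+ 2 <= delta * s n.
      by rewrite (le_trans _ hfs) // /edge_mass; lra.
    have n1 : 1 <= n.+1%:R :> R by rewrite ler1n.
    apply: (@le_trans _ _ (3 * n.+1%:R * (delta * s n))).
      by rewrite ler_pM ?sqr_ge0 //; lra.
    have := step_le hsw n; rewrite -(ler_pM2l d0); lra.
  have := ler_wpM2l L12 h3.
  set T := mass f n.+1 - mass f N => h5 h6.
  have E : mass f n.+1 = mass f N + T by rewrite /T; lra.
  have hK : 8 * L * (K * delta) = (2 + 36 * L) * delta.
    by rewrite mulrA [8 * L * K]mulrC divfK //; lra.
  have L8 : 0 < 8 * L by lra.
  rewrite -(ler_pM2l L8); rewrite E in hE h1 *.
  by lra.
(* The Wronskian is a difference of two fluxes, each at most delta / 2 in absolute value; I divides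
   out the eigenvalue gap. *)
have orth : `|\sum_(k < n.+1) p k * q k| <= I * delta.
  have e : w n * (q n * p n.+1 - p n * q n.+1) =
      (mu - lam) * \sum_(k < n.+1) p k * q k.
    rewrite -wronskian_identity mulr_sumr; apply: eq_bigr => k _.
    by rewrite hp hq; ring.
  rewrite ler_pdivlMl // distrC -normrM -e.
  have -> : w n * (q n * p n.+1 - p n * q n.+1) =
    w n * (q n * (p n.+1 - p n)) - w n * (p n * (q n.+1 - q n)) by ring.
  have := flux_bound (x := q n) (d := p n.+1 - p n) hsw _ small.
  have := flux_bound (x := p n) (d := q n.+1 - q n) hsw _ small.
  have wp0 : 0 <= w n * (p n.+1 - p n) ^+ 2 by rewrite mulr_ge0 ?sqr_ge0 ?ltW.
  have wq0 : 0 <= w n * (q n.+1 - q n) ^+ 2 by rewrite mulr_ge0 ?sqr_ge0 ?ltW.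
  have := sqr_ge0 (p n); have := sqr_ge0 (q n).
  have := sqr_ge0 (p n.+1); have := sqr_ge0 (q n.+1).
  rewrite /edge_mass => ? ? ? ? hp' hq'.
  apply: le_trans (ler_normB _ _) _.
  have {}hp' : `|w n * (p n * (q n.+1 - q n))| <= delta / 2 by apply: hp'; lra.
  have {}hq' : `|w n * (q n * (p n.+1 - p n))| <= delta / 2 by apply: hq'; lra.
  by lra.
have polar (m : nat) : 2 * \sum_(k < m) p k * q k =
    mass p m + mass q m - mass (fun k => p k - q k) m.
  rewrite /mass -big_split /= -sumrB mulr_sumr; apply: eq_bigr => k _; ring.
have tailpq : mass (fun k => p k - q k) n.+1 - D <=
   2 * (mass p n.+1 - mass p N) + 2 * (mass q n.+1 - mass q N).
  rewrite /D; move: (leqW leNn) => /subnK <-.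
  elim: (n.+1 - N)%N => [|k IH]; first by rewrite !add0n; lra.
  rewrite addSn !massS; set m := (k + N)%N in IH *.
  have := sqr_ge0 (p m + q m); lra.
have hTp : mass p n.+1 - mass p N <= mass p N / 2 + K * delta.
  by apply: tail hlam hp _; lra.
have hTq : mass q n.+1 - mass q N <= mass q N / 2 + K * delta.
  by apply: tail hmu hq _; lra.
(* Polarization and the tail bounds give 1 - D - 2 K delta <= 2 I delta, but delta was chosen with
   (K + I) delta = (1 - D) / 4, which contradicts D < 1. *)
have := polar n.+1; move/(le_trans (ler_norm _)): (orth).
have := le_trans (ler_norm _) (orth : `|_| <= _).
have hp1 : 1 <= mass p N.
  by rewrite (le_trans _ (mass_mono p N0)) // massS /mass big_ord0 p0; lra.
have hq1 : 1 <= mass q N.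
  by rewrite (le_trans _ (mass_mono q N0)) // massS /mass big_ord0 q0; lra.
move: orth; rewrite ler_norml => /andP[lo hi].
by lra.
Qed.

(** * Uniform bounds for Dirichlet problems *)

Lemma mass_solution_bound (R : rcfType) (w : nat -> R) (lam : R) (n : nat) :
  exists2 K : R, 0 <= K & forall (g : nat -> R) (B : R),
    (forall m, mass g m <= B) -> mass (solution w lam g 0) n <= K * B.
Proof.
elim: n => [|n [K K0 IH]].
  by exists 0 => // g B _; rewrite /mass big_ord0 mul0r.
have [K' K'0 hK'] := solution_bound w lam n.
exists (K + K' ^+ 2) => [|g B hB]; first by rewrite addr_ge0 ?sqr_ge0.
have B0 : 0 <= B by apply: le_trans (hB 0%N); rewrite mass_ge0.
rewrite massS mulrDl lerD ?IH // -real_normK ?num_real //.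
rewrite -[B]sqr_sqrtr // -exprMn ler_pXn2r ?nnegrE ?mulr_ge0 ?sqrtr_ge0 //.
apply: hK' => k; rewrite -sqrtr_sqr ler_sqrt //.
exact: sqr_le_mass hB.
Qed.

(** The condition f(n+1) = 0 removes the boundary terms of both Hardy and Green. Four times the
    energy is then at most (4 |lam| + 2) mass f + 2 B, and the Hardy constant 4 |lam| + 3 exceeds
    that coefficient by one. *)
Lemma dirichlet_bound (R : realFieldType) (w f g : nat -> R) (lam B : R)
    (N n : nat) :
  (forall k, 0 < w k) -> (N <= n.+1)%N ->
  (forall k, (N <= k)%N -> (4 * `|lam| + 3) * k.+1%:R ^+ 2 <= w k) ->
  (forall k, jacobi w f k = g k + lam * f k) -> f n.+1 = 0 ->
  mass g n.+1 <= B -> mass f n.+1 <= (4 * `|lam| + 3) * mass f N + 2 * B.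
Proof.
move=> w0 leNn hN hf fn gB.
have l0 := normr_ge0 lam.
have M0 : 0 <= 4 * `|lam| + 3 by lra.
have := hardy f M0 w0 hN leNn; rewrite fn expr0n mulr0 addr0.
have := green_identity w f n; rewrite fn mulr0 mul0r subr0 => <-.
have h : \sum_(k < n.+1) f k * jacobi w f k <=
    `|lam| * mass f n.+1 + (mass f n.+1 + mass g n.+1) / 2.
  rewrite /mass -big_split /= mulr_sumr mulr_suml -big_split /=.
  apply: ler_sum => k _; rewrite hf.
  have h1 := ler_wpM2r (sqr_ge0 (f k)) (ler_norm lam).
  have := sqr_ge0 (f k - g k); lra.
by lra.
Qed.

(** For each m the witness is the initial value of a Dirichlet solution on some [0, n] with n + 1 >=
    m. Unbounded mass of the eigensolution p prevents a large multiple of p from entering that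
    solution. *)
Lemma resolvent_bound (R : rcfType) (s w : nat -> R) (lam : R) :
  admissible s w ->
  (forall C : R, exists n, C < mass (eigensolution w lam) n) ->
  exists2 K : R, 0 <= K & forall (g : nat -> R) (B : R),
    (forall n, mass g n <= B) -> forall m, exists c,
    c ^+ 2 <= K * B /\ mass (solution w lam g c) m <= K * B.
Proof.
move=> hsw pinf; set p := eigensolution w lam in pinf *.
have w0 := weights_gt0 hsw.
pose M := 4 * `|lam| + 3.
have M0 : 0 <= M by rewrite /M; have := normr_ge0 lam; lra.
have [N hN] := weight_superquadratic hsw M.
(* Bounding c^2 mass p L from above produces 4 M c^2 mass p N; this L absorbs it and leaves 2 c^2 <=
   2 K1 B. *)
have [L hL] := pinf (4 * M * mass p N + 2).
have [KN KN0 hKN] := mass_solution_bound w lam N.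
have [KL KL0 hKL] := mass_solution_bound w lam L.
pose K1 := KL + 2 * M * KN + 2.
have K10 : 0 <= K1 by rewrite !addr_ge0 // !mulr_ge0.
pose K2 := M * (2 * KN + 2 * (K1 * mass p N)) + 2.
have P0 := mass_ge0 p N.
have K20 : 0 <= K2 by rewrite addr_ge0 // mulr_ge0 // addr_ge0 // !mulr_ge0.
exists (K1 + K2) => [|g B gB m]; first by rewrite addr_ge0.
have B0 : 0 <= B by apply: le_trans (gB 0%N); rewrite mass_ge0.
(* If p vanished from some vertex on, its mass would be bounded. A nonzero p(n+1) allows c to be
   solved from f(n+1) = 0. *)
have [n hn pn] : exists2 n, (maxn m (maxn L N) <= n.+1)%N & p n.+1 != 0.
  apply: contrapT => H.
  set n0 := maxn m (maxn L N) in H.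
  have [n] := pinf (mass p n0.+1); apply/negP; rewrite -leNgt.
  have [len|/ltnW/subnK <-] := leqP n n0.+1; first exact: mass_mono.
  elim: (n - n0.+1)%N => [|k IH]; first by [].
  rewrite addSn massS [p _](_ : _ = 0) ?expr0n ?addr0 //.
  apply: contrapT => /eqP hp; apply: H; exists (k + n0)%N.
    by rewrite -addnS (leq_trans (leqnSn _)) // leq_addl.
  by rewrite -addnS.
move: hn; rewrite !geq_max => /and3P[lemn leLn leNn].
set v := solution w lam g 0.
pose c := - v n.+1 / p n.+1.
pose f := solution w lam g c.
have fE k : f k = v k + c * p k by exact: solution_affine.
have fn : f n.+1 = 0 by rewrite fE /c divfK // subrr.
have F := dirichlet_bound w0 leNn hN (solutionP lam g c w0) fn (gB n.+1).
have S : mass f N <= 2 * mass v N + 2 * (c ^+ 2 * mass p N).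
  rewrite /mass !mulr_sumr -big_split /=; apply: ler_sum => k _.
  by rewrite fE; have := sqr_ge0 (v k - c * p k); lra.
have FL : c ^+ 2 * mass p L <= 2 * mass f L + 2 * mass v L.
  rewrite /mass !mulr_sumr -big_split /=; apply: ler_sum => k _.
  by rewrite fE; have := sqr_ge0 (2 * v k + c * p k); lra.
have vN := hKN g B gB; have vL := hKL g B gB.
rewrite -/v in vN vL; rewrite -/f -/M in F.
have fL := mass_mono f leLn.
have c20 := sqr_ge0 c.
have hMS := ler_wpM2l M0 S; have hMV := ler_wpM2l M0 vN.
have hc : c ^+ 2 <= K1 * B.
  have := ler_wpM2l c20 (ltW hL); rewrite /K1.
  by lra.
have hcP := ler_wpM2l M0 (ler_wpM2r P0 hc).
have hF : mass f n.+1 <= K2 * B by rewrite /K2; lra.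
exists c; rewrite mulrDl; split.
  by rewrite (le_trans hc) // lerDl mulr_ge0.
by rewrite (le_trans (mass_mono f lemn)) // (le_trans hF) // lerDr mulr_ge0.
Qed.

(** * The half-line as a weighted graph *)

Lemma esum_massE (R : realType) (f : nat -> R) :
  (\esum_(x in [set: nat]) ((f x) ^+ 2)%:E = limn (fun n => (mass f n)%:E))%E.
Proof.
rewrite -nneseries_esumT => [|n]; last by rewrite lee_fin sqr_ge0.
by congr (lim (_ @ \oo)); apply/funext => n; rewrite sumEFin big_mkord.
Qed.

Lemma mass_le_esum (R : realType) (f : nat -> R) (n : nat) :
  ((mass f n)%:E <= \esum_(x in [set: nat]) ((f x) ^+ 2)%:E)%E.
Proof.
rewrite -nneseries_esumT => [|k]; last by rewrite lee_fin sqr_ge0.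
rewrite /mass -sumEFin -(big_mkord xpredT (fun k => (f k ^+ 2)%:E)).
by apply: nneseries_lim_ge => k _ _; rewrite lee_fin sqr_ge0.
Qed.

Lemma mass_le_norm (R : realType) (f : nat -> R) (n : nat) :
  ell2 f -> mass f n <= ell2_norm f ^+ 2.
Proof.
rewrite /ell2 /= => hf; rewrite /ell2_norm sqr_sqrtr; last first.
  by rewrite fine_ge0 // esum_ge0 // => k _; rewrite lee_fin sqr_ge0.
rewrite -lee_fin fineK ?mass_le_esum // ge0_fin_numE //.
by rewrite esum_ge0 // => k _; rewrite lee_fin sqr_ge0.
Qed.

Lemma ell2_mass_bounded (R : realType) (f : nat -> R) (C : R) :
  (forall n, mass f n <= C) -> ell2 f /\ ell2_norm f ^+ 2 <= C.
Proof.
move=> hC.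
have h0 : (0 <= \esum_(x in [set: nat]) ((f x) ^+ 2)%:E)%E.
  by rewrite esum_ge0 // => k _; rewrite lee_fin sqr_ge0.
have h : (\esum_(x in [set: nat]) ((f x) ^+ 2)%:E <= C%:E)%E.
  rewrite esum_massE; apply: lime_le; last by near=> n; rewrite lee_fin.
  apply: ereal_nondecreasing_is_cvgn => m n lemn.
  by rewrite lee_fin mass_mono.
have hlt : ell2 f by rewrite /ell2 /= (le_lt_trans h) // ltry.
split=> //; rewrite /ell2_norm sqr_sqrtr ?fine_ge0 //.
by rewrite -lee_fin fineK // ge0_fin_numE.
Unshelve. all: by end_near. Qed.

Lemma ell2P (R : realType) (f : nat -> R) :
  ell2 f <-> exists C, forall n, mass f n <= C.
Proof.
split=> [hf|[C hC]]; last by have [] := ell2_mass_bounded hC.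
by exists (ell2_norm f ^+ 2) => n; apply: mass_le_norm.
Qed.

Lemma ell2_lin (R : realType) (f g : nat -> R) (a : R) :
  ell2 f -> ell2 g -> ell2 (fun x => f x - a * g x).
Proof.
move=> /ell2P[C hC] /ell2P[D hD]; apply/ell2P.
exists (2 * C + 2 * (a ^+ 2 * D)) => n.
apply: (@le_trans _ _ (2 * mass f n + 2 * (a ^+ 2 * mass g n))).
  rewrite /mass !mulr_sumr -big_split; apply: ler_sum => k _ /=.
  have := sqr_ge0 (f k + a * g k); lra.
have := ler_wpM2l (sqr_ge0 a) (hD n); have := hC n; lra.
Qed.

Definition path_adj : rel nat := fun x y => (x.+1 == y) || (y.+1 == x).

Definition path_weight (R : realType) (w : nat -> R) (x y : nat) : R :=
  if path_adj x y then w (minn x y) else 0.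

Lemma path_adj_sym x y : path_adj x y = path_adj y x.
Proof. by rewrite /path_adj orbC. Qed.

Lemma path_adj_irrefl x : ~~ path_adj x x.
Proof. by rewrite /path_adj orbb -addn1 -[X in _ == X]addn0 eqn_add2l. Qed.

Lemma path_adj_finite x : finite_set [set y | path_adj x y].
Proof.
apply: (@sub_finite_set _ _ `I_x.+2); last exact: finite_II.
by move=> y /= /orP[] /eqP <-; rewrite ?leqnn // ltnS ltnW.
Qed.

Lemma path_adj_connected x y :
  exists p : seq nat, path path_adj x p /\ last x p = y.
Proof.
have [p [hp lp]] : exists p, path path_adj x p /\ last x p = 0%N.
  elim: x => [|x [p [hp lp]]]; first by exists [::].
  by exists (x :: p); rewrite /= hp lp /path_adj eqxx orbT.
have [q [hq lq]] : exists p, path path_adj 0%N p /\ last 0%N p = y.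
  elim: y => [|y [q [hq lq]]]; first by exists [::].
  exists (rcons q y.+1); rewrite rcons_path hq lq last_rcons.
  by rewrite /path_adj eqxx.
by exists (p ++ q); rewrite cat_path last_cat lp hp hq.
Qed.

Lemma path_weight_sym (R : realType) (w : nat -> R) x y :
  path_weight w x y = path_weight w y x.
Proof. by rewrite /path_weight path_adj_sym minnC. Qed.

Lemma path_weight_ge0 (R : realType) (w : nat -> R) :
  (forall k, 0 < w k) -> forall x y, 0 <= path_weight w x y.
Proof.
by move=> w0 x y; rewrite /path_weight; case: ifP => // _; rewrite ltW.
Qed.

Lemma path_weight_gt0 (R : realType) (w : nat -> R) :
  (forall k, 0 < w k) -> forall x y, 0 < path_weight w x y <-> path_adj x y.
Proof.
by move=> w0 x y; rewrite /path_weight; case: ifP => // _; rewrite ltxx.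
Qed.

Definition path_graph (R : realType) (w : nat -> R) (w0 : forall k, 0 < w k) :
    weighted_graph R :=
  @WeightedGraph R nat infinite_nat path_adj path_adj_sym path_adj_irrefl
    path_adj_finite path_adj_connected (path_weight w) (path_weight_sym w)
    (path_weight_ge0 w0) (path_weight_gt0 w0).

Lemma path_neighbors0 : [set y | path_adj 0 y] = [set 1%N].
Proof.
apply/seteqP; split=> y /=; last by move=> ->.
by rewrite /path_adj orbF => /eqP.
Qed.

Lemma path_neighborsS n :
  [set y | path_adj n.+1 y] = [set n] `|` [set n.+2].
Proof.
apply/seteqP; split=> y /=; rewrite /path_adj eqSS.
  by move=> /orP[/eqP <-|/eqP ->]; [right|left].
by move=> [->|->]; rewrite eqxx ?orbT.
Qed.

Lemma fsbig_path_adj (R : realType) (F : nat -> R) (n : nat) :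
  \sum_(y \in [set y | path_adj n y]) F y =
  F n.+1 + (if n is m.+1 then F m else 0).
Proof.
case: n => [|n]; first by rewrite path_neighbors0 fsbig_set1 addr0.
rewrite path_neighborsS fsbigU //= ?fsbig_set1 1?addrC //.
by move=> y [/= -> /eqP]; rewrite -addn2 -[X in X == _]addn0 eqn_add2l.
Qed.

Lemma neg_laplacian_pathE (R : realType) (w : nat -> R)
    (w0 : forall k, 0 < w k) (f : nat -> R) (n : nat) :
  neg_laplacian1 (Gamma := path_graph w0) f n = jacobi w f n.
Proof.
rewrite /neg_laplacian1 /laplacian1 fsbig_path_adj /jacobi /= /path_weight.
rewrite /path_adj eqxx /= (minn_idPl (leqnSn _)).
case: n => [|n]; rewrite ?addr0; first by ring.
by rewrite eqxx orbT (minn_idPr (leqnSn _)); ring.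
Qed.

(** * Continuity in the parameters and passage to the limit *)

Lemma continuous_solution_initial (R : realType) (w : nat -> R) (lam : R)
    (g : nat -> R) (m : nat) :
  continuous (fun c => mass (solution w lam g c) m).
Proof.
move=> c; elim: m => [|m IH].
  rewrite (_ : (fun _ => _) = (fun=> 0)); first exact: cvg_cst.
  by apply/funext => x; rewrite /mass big_ord0.
rewrite (_ : (fun _ => _) = (fun c => mass (solution w lam g c) m +
    (solution w lam g 0 m + c * eigensolution w lam m) *
    (solution w lam g 0 m + c * eigensolution w lam m))).
  apply: cvgD; first exact: IH.
  by apply: cvgM; (apply: cvgD; [exact: cvg_cst|]);
    (apply: cvgM; [exact: cvg_id|exact: cvg_cst]).
by apply/funext => x; rewrite massS -expr2 [solution _ _ _ x m]solution_affine.
Qed.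

Lemma continuous_eigensolution (R : realType) (w : nat -> R) (n : nat) :
  continuous (fun lam => eigensolution w lam n).
Proof.
move=> lam; suff [] : (shoot w l (fun=> 0) 1 n).1 @[l --> lam] -->
    (shoot w lam (fun=> 0) 1 n).1 /\
  (shoot w l (fun=> 0) 1 n).2 @[l --> lam] -->
    (shoot w lam (fun=> 0) 1 n).2 by [].
elim: n => [|n [IH1 IH2]]; first by split; exact: cvg_cst.
have J : (shoot w l (fun=> 0) 1 n).2 + (0 + l * (shoot w l (fun=> 0) 1 n).1)
    @[l --> lam] --> (shoot w lam (fun=> 0) 1 n).2 +
    (0 + lam * (shoot w lam (fun=> 0) 1 n).1).
  apply: cvgD; first exact: IH2.
  by apply: cvgD; [exact: cvg_cst|apply: cvgM; [exact: cvg_id|exact: IH1]].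
split=> //=; apply: cvgB; first exact: IH1.
by apply: cvgM; [exact: J|exact: cvg_cst].
Qed.

(** The initial values from [resolvent_bound] lie in a compact interval. A cluster point works for
    every m, since the bound on the mass up to m is a closed condition on c satisfied by all the
    values of index at least m. *)
Lemma solution_bounded (R : realType) (s w : nat -> R) (lam : R) :
  admissible s w -> ~ ell2 (eigensolution w lam) ->
  exists2 K : R, 0 <= K & forall (g : nat -> R) (B : R),
    (forall n, mass g n <= B) -> exists c, forall m,
    mass (solution w lam g c) m <= K * B.
Proof.
move=> hsw pinf.
have [|K K0 hK] := @resolvent_bound _ s w lam hsw.
  move=> C; apply: contrapT => H; apply: pinf; apply/ell2P; exists C => n.
  by rewrite leNgt; apply/negP => h; apply: H; exists n.
exists K => // g B gB.
have /choice[c hc] := hK g B gB.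
pose A := Num.sqrt (K * B).
have KB0 : 0 <= K * B.
  by have [h _] := hc 0%N; apply: le_trans h; exact: sqr_ge0.
have cA n : c n \in `[- A, A].
  rewrite in_itv /= -ler_norml -sqrtr_sqr ler_sqrt //.
  by have [] := hc n.
have [|x [_ cx]] := @segment_compact R (- A) A (c @ \oo) _.
  by exists 0%N => // n _; exact: cA n.
exists x => m.
pose S := [set c | mass (solution w lam g c) m <= K * B].
have clS : closed S.
  apply: (@preimage_closed _ _ (fun c => mass (solution w lam g c) m)
    [set y | y <= K * B]); last exact: closed_le.
  by move=> y _; exact: continuous_solution_initial.
suff : S x by [].
apply: clS => U Ux; apply: cx => //.
exists m => // n lemn; have [_ h] := hc n; apply: le_trans h.
exact: mass_mono.
Qed.

(** * The spectrum *)

Lemma path_laplacian_domainE (R : realType) (w : nat -> R)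
    (w0 : forall k, 0 < w k) (f : nat -> R) :
  laplacian1_domain (Gamma := path_graph w0) f <->
  ell2 f /\ ell2 (jacobi w f).
Proof.
have E : mass (laplacian1 (Gamma := path_graph w0) f) = mass (jacobi w f).
  apply/funext => n; rewrite /mass; apply: eq_bigr => k _.
  by rewrite -(neg_laplacian_pathE w0) sqrrN.
by split=> -[f2 /ell2P[C hC]]; split=> //; apply/ell2P; exists C => n;
  move: (hC n); rewrite -?E // E.
Qed.

Lemma solution_in_domain (R : realType) (w : nat -> R)
    (w0 : forall k, 0 < w k) (f : nat -> R) (lam : R) (g : nat -> R) :
  ell2 f -> ell2 g -> (forall n, jacobi w f n = g n + lam * f n) ->
  laplacian1_domain (Gamma := path_graph w0) f.
Proof.
move=> f2 g2 hf; apply/path_laplacian_domainE; split=> //.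
rewrite (_ : jacobi w f = fun n => g n - (- lam) * f n); first exact: ell2_lin.
by apply/funext => n; rewrite hf mulNr opprK.
Qed.

(** A kernel element is a multiple of the eigensolution, hence zero, which gives injectivity;
    [solution_bounded] gives surjectivity. *)
Lemma noneigenvalue_resolvent (R : realType) (s w : nat -> R)
    (w0 : forall k, 0 < w k) (lam : R) :
  admissible s w -> ~ ell2 (eigensolution w lam) ->
  resolvent_set (laplacian1_domain (Gamma := path_graph w0))
    (neg_laplacian1 (Gamma := path_graph w0)) lam.
Proof.
move=> hsw pinf.
pose Bop (f : nat -> R) n := jacobi w f n - lam * f n.
have BE (f : nat -> R) : (fun x : path_graph w0 =>
    neg_laplacian1 (Gamma := path_graph w0) f x - lam * f x) = Bop f.
  by apply/funext => n; rewrite neg_laplacian_pathE.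
have inj (f h : nat -> R) : ell2 f -> ell2 h -> Bop f = Bop h -> f = h.
  move=> f2 h2 e; pose d n := f n - 1 * h n.
  have hd n : jacobi w d n = lam * d n.
    have := congr1 (@^~ n) e; rewrite /Bop /jacobi /d.
    by case: n => [|n] => e'; lra.
  have d2 : ell2 d by exact: ell2_lin.
  have hdE := eigenfunctionE w0 hd.
  have d0 : d 0%N = 0.
    apply: contrapT => /eqP d0; apply: pinf; apply/ell2P.
    have /ell2P[C hC] := d2.
    have dd0 : 0 < d 0%N ^+ 2 by rewrite exprn_even_gt0.
    exists (C / d 0%N ^+ 2) => n; rewrite ler_pdivlMr // mulrC.
    apply: le_trans (hC n); rewrite /mass mulr_sumr.
    by apply: ler_sum => k _; rewrite -exprMn -hdE.
  apply/funext => n; apply/eqP; rewrite -subr_eq0.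
  by have := hdE n; rewrite d0 mul0r /d mul1r => ->.
have [K K0 hK] := solution_bounded hsw pinf.
have surj (g : nat -> R) (B : R) : (forall n, mass g n <= B) ->
    exists f : nat -> R,
      [/\ ell2 f, ell2_norm f ^+ 2 <= K * B &
          forall n, jacobi w f n = g n + lam * f n].
  move=> gB; have [c hc] := hK g B gB.
  have [h1 h2] := ell2_mass_bounded hc.
  by exists (solution w lam g c); split=> //; exact: solutionP.
have BopE (f g : nat -> R) : (forall n, jacobi w f n = g n + lam * f n) ->
    Bop f = g by move=> h; apply/funext => n; rewrite /Bop h addrK.
split; first split.
- move=> f /path_laplacian_domainE[f2 Jf2]; rewrite /= BE; exact: ell2_lin.
- move=> f h /set_mem /path_laplacian_domainE[f2 _].
  move=> /set_mem /path_laplacian_domainE[h2 _].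
  by rewrite !BE; exact: inj.
- move=> g g2; have [f [f2 _ hf]] := surj g _ (fun n => mass_le_norm n g2).
  exists f; first exact: solution_in_domain hf.
  by rewrite BE; exact: BopE.
exists (Num.sqrt K) => f /path_laplacian_domainE[f2 Jf2]; rewrite BE.
have g2 : ell2 (Bop f) by exact: ell2_lin.
(* The estimate is known for the constructed preimage h; injectivity transfers it to f. The root
   appears because K compares squared norms. *)
have [h [h2 hle hh]] := surj _ _ (fun n => mass_le_norm n g2).
have -> : f = h by apply: inj => //; rewrite (BopE _ _ hh).
have -> : Bop h = Bop f by exact: BopE.
have n0 (u : nat -> R) : 0 <= ell2_norm u by exact: sqrtr_ge0.
suff H : ell2_norm h <= Num.sqrt K * ell2_norm (Bop f) by exact: H.
move: hle (n0 h) (n0 (Bop f)).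
move: (ell2_norm h) (ell2_norm (Bop f)) => a b hab a0 b0.
by rewrite -ler_sqr ?nnegrE ?mulr_ge0 ?sqrtr_ge0 // exprMn sqr_sqrtr.
Qed.

Lemma spectrum_eigenvalue (R : realType) (s w : nat -> R)
    (w0 : forall k, 0 < w k) (lam : R) : admissible s w ->
  spectrum (laplacian1_domain (Gamma := path_graph w0))
    (neg_laplacian1 (Gamma := path_graph w0)) lam ->
  ell2 (eigensolution w lam).
Proof.
move=> hsw hlam; apply: contrapT => h; apply: hlam.
exact: noneigenvalue_resolvent hsw h.
Qed.

Lemma eigenvalues_not_limit_point (R : realType) (s w : nat -> R) (lam : R) :
  admissible s w ->
  ell2 (eigensolution w lam) ->
  ~ limit_point [set mu | ell2 (eigensolution w mu)] lam.
Proof.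
move=> hsw lam2 hlim; have w0 := weights_gt0 hsw.
(* L bounds every mu within distance 1 of lam, so one N serves all of them. There F is continuous
   with F(lam) = 0, against F(mu) >= 1 from [eigenfunctions_apart]. *)
pose L := `|lam| + 1.
have L0 : 0 < L by rewrite ltr_pwDr.
have [N1 hN1] := weight_superquadratic hsw (12 * L).
pose N := N1.+1.
have hN k : (N <= k)%N -> 12 * L * k.+1%:R ^+ 2 <= w k.
  by move=> /ltnW; exact: hN1.
pose F mu := mass (fun k => eigensolution w mu k - eigensolution w lam k) N.
have Fc : F x @[x --> lam] --> 0.
  have -> : 0 = F lam.
    by rewrite /F /mass big1 // => k _; rewrite subrr expr0n.
  rewrite /F; elim: (N) => [|m IH].
    rewrite /mass (_ : (fun _ => _) = (fun=> 0)).
      by rewrite big_ord0; exact: cvg_cst.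
    by apply/funext => x; rewrite big_ord0.
  under eq_fun do rewrite massS expr2.
  rewrite massS expr2; apply: cvgD => //.
  by apply: cvgM; (apply: cvgB;
    [exact: continuous_eigensolution|exact: cvg_cst]).
have [|mu [neq mu2 [Fmu dmu]]] := hlim [set mu | F mu < 1 /\ `|lam - mu| < 1].
  have h1 : \forall x \near lam, F x < 1 by apply: (cvgr_lt _ Fc); exact: ltr01.
  have h2 : \forall x \near lam, `|lam - x| < 1 by exact: nbhsx_ballx.
  by apply: filterS2 h1 h2.
have /ell2P[C hC] := lam2; have /ell2P[D hD] := mu2.
have hmu : `|mu| <= L.
  rewrite -[mu](subKr lam) /L (le_trans (ler_normB _ _)) // lerD2l.
  exact: ltW.
have hlam : `|lam| <= L by rewrite lerDl.
have E nu n : jacobi w (eigensolution w nu) n = nu * eigensolution w nu n.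
  by rewrite (solutionP nu (fun=> 0) 1 w0) add0r.
move: Fmu; apply/negP; rewrite -leNgt.
apply: (@eigenfunctions_apart _ s w _ _ mu lam L (Num.max C D)) => //.
- by move=> n; rewrite le_max hD orbT.
- by move=> n; rewrite le_max hC.
Qed.

Lemma path_eigenspace_finite (R : realType) (w : nat -> R)
    (w0 : forall k, 0 < w k) (lam : R) :
  ~ infinite_dimensional (Defs.eigenspace
    (laplacian1_domain (Gamma := path_graph w0))
    (neg_laplacian1 (Gamma := path_graph w0)) lam).
Proof.
move=> /(_ 2%N)[e [he free]].
have eE i := @eigenfunctionE R w lam (e i) w0
  (fun k => etrans (esym (neg_laplacian_pathE w0 (e i) k)) ((he i).2 k)).
pose i1 : 'I_2 := lift ord0 ord0.
have indep (a b : R) : (forall n, a * e ord0 n + b * e i1 n = 0) ->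
    a = 0 /\ b = 0.
  move=> hab.
  have h : forall j : 'I_2, (if j == ord0 then a else b) = 0.
    apply: (free (fun j => if j == ord0 then a else b)) => n.
    by rewrite big_ord_recl big_ord1 /=; exact: hab.
  by split; [have := h ord0|have := h i1].
(* Both functions are multiples of the eigensolution, so cross-multiplying by their values at 0
   gives a dependence. It forces both values to be 0, and then both functions vanish. *)
have [e1 e0] : e i1 0%N = 0 /\ - e ord0 0%N = 0.
  by apply: indep => n; rewrite (eE ord0 n) (eE i1 n); ring.
have [one0 _] : (1 : R) = 0 /\ (1 : R) = 0.
  apply: indep => n; rewrite (eE ord0 n) (eE i1 n) e1.
  by rewrite -[e ord0 0%N]opprK e0 oppr0 !mul0r mulr0 addr0.
by move/eqP: one0; rewrite oner_eq0.
Qed.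

Lemma path_essential_spectrum (R : realType) (s w : nat -> R)
    (w0 : forall k, 0 < w k) : admissible s w ->
  essential_spectrum (laplacian1_domain (Gamma := path_graph w0))
    (neg_laplacian1 (Gamma := path_graph w0)) = set0.
Proof.
move=> hsw; apply/seteqP; split=> // lam [slam [hlim|[_ hinf]]]; last first.
  exact: path_eigenspace_finite hinf.
apply: (eigenvalues_not_limit_point hsw (spectrum_eigenvalue hsw slam)).
move=> U Ux; have [mu [neq smu Umu]] := hlim U Ux.
by exists mu; split=> //; exact: spectrum_eigenvalue hsw smu.
Qed.

(** * Choice of the weights and volume growth *)

(** The added 1 keeps the base of all powers at least 1 and puts vertex 0 at coordinate 1. *)
Definition logarg (R : realType) (n : nat) : R := 1 + ln (n.+1%:R : R).

Definition coordinate (R : realType) (beta : R) (n : nat) : R :=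
  logarg R n `^ beta.

Definition step (R : realType) (beta : R) (n : nat) : R :=
  coordinate beta n.+1 - coordinate beta n.

Definition step_weight (R : realType) (beta : R) (n : nat) : R :=
  (2 * step beta n ^+ 2)^-1.

Lemma logarg_ge1 (R : realType) n : 1 <= logarg R n.
Proof. by rewrite lerDl ln_ge0 // ler1n. Qed.

Lemma logarg_lt (R : realType) m n : (m < n)%N -> logarg R m < logarg R n.
Proof. by move=> lt; rewrite ltrD2l ltr_ln ?posrE ?ltr0n // ltr_nat. Qed.

Lemma logarg_unbounded (R : realType) (X : R) :
  exists N, forall n, (N <= n)%N -> X <= logarg R n.
Proof.
exists (Num.trunc (expR X)) => n leNn.
have h : expR X <= n.+1%:R.
  by rewrite ltW // (lt_le_trans (truncnS_gt _)) // ler_nat.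
rewrite -(expRK X) (@le_trans _ _ (ln n.+1%:R)) ?lerDr //.
by rewrite ler_ln ?posrE ?expR_gt0.
Qed.

Lemma coordinate0 (R : realType) (beta : R) : coordinate beta 0 = 1.
Proof. by rewrite /coordinate /logarg ln1 addr0 powR1. Qed.

Lemma powR_ge1 (R : realType) (x r : R) : 1 <= x -> 0 <= r -> 1 <= x `^ r.
Proof.
move=> x1 r0; have : 1 `^ r <= x `^ r.
  by rewrite ge0_ler_powR ?nnegrE // (le_trans ler01).
by rewrite powR1.
Qed.

Lemma coordinate_ge1 (R : realType) (beta : R) n :
  0 <= beta -> 1 <= coordinate beta n.
Proof. by move=> b0; rewrite powR_ge1 // logarg_ge1. Qed.

Lemma step_positive (R : realType) (beta : R) n : 0 < beta -> 0 < step beta n.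
Proof.
move=> b0; have p k : 0 <= logarg R k by rewrite (le_trans ler01) // logarg_ge1.
by rewrite subr_gt0 gt0_ltr_powR ?nnegrE // logarg_lt.
Qed.

(** With x = [logarg R n] and d = 1 / ((n + 1) x), ln(1 + t) <= t bounds the next [logarg] by x (1 +
    d), and (1 + d)^beta <= 1 + d bounds the step by x^beta d. For beta < 1 the resulting bound
    tends to 0. *)
Lemma step_bound (R : realType) (beta : R) n :
  0 <= beta -> beta <= 1 ->
  n.+1%:R * step beta n <= (logarg R n `^ (1 - beta))^-1.
Proof.
move=> b0 b1; rewrite /step /coordinate.
have x1 := logarg_ge1 R n; set x := logarg R n in x1 *.
have x0 : 0 < x by rewrite (lt_le_trans ltr01).
have n0 : 0 < n.+1%:R :> R by rewrite ltr0n.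
pose d := n.+1%:R^-1 / x.
have d0 : 0 <= d by rewrite divr_ge0 ?invr_ge0 // ltW.
have h1 : logarg R n.+1 <= x * (1 + d).
  rewrite mulrDr mulr1 [x * d]mulrC /d divfK ?lt0r_neq0 //.
  rewrite /x /logarg -addrA lerD2l.
  have -> : n.+2%:R = n.+1%:R * (1 + n.+1%:R^-1) :> R.
    by rewrite mulrDr mulr1 divff ?lt0r_neq0 // natr1.
  have i0 : 0 < n.+1%:R^-1 :> R by rewrite invr_gt0.
  rewrite lnM ?posrE ?addr_gt0 // lerD2l le_ln1Dx //.
  by rewrite (lt_trans _ i0) // ltrN10.
have h2 : logarg R n.+1 `^ beta <= x `^ beta * (1 + d).
  apply: (@le_trans _ _ ((x * (1 + d)) `^ beta)).
    have l0 : 0 <= logarg R n.+1 by rewrite (le_trans ler01) // logarg_ge1.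
    by rewrite ge0_ler_powR ?nnegrE // (le_trans l0 h1).
  rewrite powRM ?(ltW x0) ?addr_ge0 // ler_wpM2l ?powR_ge0 //.
  by rewrite ler1_powR // lerDl.
rewrite -powRN opprB powRD ?lt0r_neq0 ?implybT // powRN powRr1 ?(ltW x0) //.
have -> : x `^ beta / x = n.+1%:R * (x `^ beta * d).
  by rewrite /d; field; rewrite !lt0r_neq0.
by rewrite ler_pM2l // lerBlDr -[X in _ <= _ + X]mulr1 -mulrDr addrC.
Qed.

Lemma step_le1 (R : realType) (beta : R) n : 0 <= beta -> beta <= 1 ->
  n.+1%:R * step beta n <= 1.
Proof.
move=> b0 b1; rewrite (le_trans (step_bound n b0 b1)) // invf_le1.
  by rewrite powR_ge1 ?logarg_ge1 // subr_ge0.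
by rewrite powR_gt0 // (lt_le_trans ltr01) // logarg_ge1.
Qed.

Lemma sum_step (R : realType) (beta : R) n :
  \sum_(k < n) step beta k = coordinate beta n - 1.
Proof.
elim: n => [|n IH]; first by rewrite big_ord0 coordinate0 subrr.
by rewrite big_ord_recr /= IH /step; ring.
Qed.

Lemma powR_unbounded (R : realType) (beta X : R) : 0 < beta ->
  exists N, forall n, (N <= n)%N -> X <= logarg R n `^ beta.
Proof.
move=> b0; have [N hN] := logarg_unbounded (`|X| `^ beta^-1).
exists N => n /hN h; rewrite (le_trans (ler_norm _)) //.
have -> : `|X| = (`|X| `^ beta^-1) `^ beta.
  by rewrite -powRrM mulVf ?lt0r_neq0 // powRr1.
rewrite ge0_ler_powR ?nnegrE ?powR_ge0 ?(ltW b0) //.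
by rewrite (le_trans ler01) // logarg_ge1.
Qed.

Lemma step_admissible (R : realType) (beta : R) : 0 < beta -> beta < 1 ->
  admissible (step beta) (step_weight beta).
Proof.
move=> b0 b1; have sp k := step_positive k b0.
split=> //.
- by move=> k; apply: step_le1; exact: ltW.
- move=> K; have [N hN] := powR_unbounded (K + 2) b0.
  exists N; rewrite sum_step ltrBrDr.
  by rewrite (lt_le_trans _ (hN N (leqnn _))) //; lra.
move=> M; have b1' : 0 < 1 - beta by rewrite subr_gt0.
(* From z y <= 1 and y >= 1 + 2 |M| follow z <= 1 and 2 |M| z <= 1, hence 2 M z^2 <= 1, which is M
   (k + 1)^2 <= w(k). *)
have [N hN] := powR_unbounded (1 + 2 * `|M|) b1'.
exists N => k /hN; set y := logarg R k `^ _ => hy.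
have M0 := normr_ge0 M.
have y0 : 0 < y by apply: lt_le_trans hy; lra.
have k0 : 0 < k.+1%:R :> R by rewrite ltr0n.
have h1 := step_bound k (ltW b0) (ltW b1).
have h2 : k.+1%:R * step beta k * y <= 1.
  by rewrite -ler_pdivlMr // mul1r.
set z := k.+1%:R * step beta k in h1 h2.
have z0 : 0 < z by rewrite mulr_gt0.
have h3 : 2 * M * z ^+ 2 <= 1.
  have h4 : z * (1 + 2 * `|M|) <= 1 by apply: le_trans h2; rewrite ler_pM2l.
  have h5 : z <= 1.
    apply: le_trans h4; rewrite mulrDr mulr1 lerDl.
    by rewrite mulr_ge0 ?(ltW z0) ?mulr_ge0.
  have h6 : 2 * M * z ^+ 2 <= 2 * `|M| * z ^+ 2.
    by rewrite ler_wpM2r ?sqr_ge0 // ler_pM2l // ler_norm.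
  apply: le_trans h6 _.
  have := ler_wpM2l (_ : 0 <= z * `|M|) h5 => /(_ (mulr_ge0 (ltW z0) M0)).
  by move=> h7; lra.
rewrite /step_weight -[X in _ <= X]mul1r ler_pdivlMr; last first.
  by rewrite mulr_gt0 // exprn_gt0.
by move: h3; rewrite /z exprMn; lra.
Qed.

Definition path_metric (R : realType) (beta : R) (x y : nat) : R :=
  `|coordinate beta x - coordinate beta y|.

Lemma path_metric_adapted (R : realType) (beta : R)
    (w0 : forall k, 0 < step_weight beta k) : 0 < beta -> beta < 1 ->
  adapted_metric (Gamma := path_graph w0) (path_metric beta).
Proof.
move=> b0 b1; have sp k := step_positive k b0.
have ltc m n : (m < n)%N -> coordinate beta m < coordinate beta n.
  have p k : 0 <= logarg R k by rewrite (le_trans ler01) // logarg_ge1.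
  by move=> lt; rewrite gt0_ltr_powR ?nnegrE // logarg_lt.
(* Each edge contributes one half, and a vertex has at most two edges. *)
have half k : step_weight beta k * path_metric beta k k.+1 ^+ 2 = 2^-1.
  rewrite /path_metric distrC real_normK ?num_real //.
  rewrite /step_weight -/(step beta k).
  by have := lt0r_neq0 (sp k) => ?; field.
have sym x y : path_metric beta x y = path_metric beta y x by exact: distrC.
split; first split.
- by move=> x y; exact: normr_ge0.
- move=> x y; split=> [/eqP|->]; last by rewrite /path_metric subrr normr0.
  rewrite normr_eq0 subr_eq0 => /eqP e.
  by case: (ltngtP x y) => // /ltc; rewrite e ltxx.
- exact: sym.
- by move=> x y z; exact: ler_distD.
- move=> x; rewrite fsbig_path_adj /= /path_weight.
  rewrite /path_adj eqxx /= (minn_idPl (leqnSn _)) half.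
  case: x => [|x]; first by lra.
  by rewrite eqxx orbT (minn_idPr (leqnSn _)) sym half; lra.
exists 1 => // x y.
have le1 k : path_metric beta k k.+1 <= 1.
  rewrite /path_metric distrC -/(step beta k) gtr0_norm //.
  have := step_le1 k (ltW b0) (ltW b1); apply: le_trans.
  by rewrite ler_peMl ?ler1n // ltW.
by move=> /orP[] /eqP <-; [|rewrite sym]; exact: le1.
Qed.

Lemma path_volume (R : realType) (eps r : R)
    (w0 : forall k, 0 < step_weight (1 + eps)^-1 k) : 0 < eps -> 0 <= r ->
  (volume (Gamma := path_graph w0) (path_metric (1 + eps)^-1) 0%N r <=
   (expR ((1 + r) `^ (1 + eps)))%:E)%E.
Proof.
move=> e0 r0; set beta := (1 + eps)^-1.
have e1 : 0 < 1 + eps by rewrite addr_gt0.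
have b0 : 0 < beta by rewrite invr_gt0.
set Y := expR _; rewrite /volume /metric_ball /counting.
set A := [set x | _].
(* Points of the ball have [coordinate] at most 1 + r; raising to the power 1 + eps undoes beta and
   gives x + 1 <= Y, so x is strictly below the truncation of Y. *)
have sub : A `<=` `I_(Num.trunc Y).
  move=> x; rewrite /A /= /path_metric coordinate0 distrC.
  rewrite ger0_norm ?subr_ge0 ?(coordinate_ge1 _ (ltW b0)) // lerBlDl => h.
  have lx0 : 0 <= logarg R x by rewrite (le_trans ler01) // logarg_ge1.
  have h1 : logarg R x <= (1 + r) `^ (1 + eps).
    have -> : logarg R x = coordinate beta x `^ (1 + eps).
      by rewrite /coordinate -powRrM mulVf ?lt0r_neq0 // powRr1.
    by rewrite ge0_ler_powR ?nnegrE ?powR_ge0 ?addr_ge0 // ltW.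
  have x0 : 0 < x.+1%:R :> R by rewrite ltr0n.
  have h2 : x.+1%:R <= Y.
    rewrite -[x.+1%:R]lnK ?posrE // ler_expR (le_trans _ h1) // lerDr //.
  have := truncn_itv (ltW (expR_gt0 ((1 + r) `^ (1 + eps)))) => /andP[_ h3].
  by have := le_lt_trans h2 h3; rewrite ltr_nat ltnS.
have fA : finite_set A by apply: sub_finite_set sub _; exact: finite_II.
rewrite asboolT // lee_fin.
apply: (@le_trans _ _ (Num.trunc Y)%:R); last first.
  by have /andP[] := truncn_itv (ltW (expR_gt0 ((1 + r) `^ (1 + eps)))).
by rewrite ler_nat geq_card_fset_set // subset_card_le.
Qed.

Lemma path_volume_growth (R : realType) (eps : R)
    (w0 : forall k, 0 < step_weight (1 + eps)^-1 k) : 0 < eps ->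
  (limf_esup
     (fun r : R => ((r `^ (1 + eps))^-1)%:E *
        lne (volume (Gamma := path_graph w0) (path_metric (1 + eps)^-1) 0%N r))
     (pinfty_nbhs R) < +oo)%E.
Proof.
move=> e0; have e1 : 0 < 1 + eps by rewrite addr_gt0.
(* For r >= 1, 1 + r <= 2 r, so the quotient is at most 2^(1 + eps). *)
apply: (@le_lt_trans _ _ (2 `^ (1 + eps))%:E); last exact: ltry.
pose f (r : R) := (((r `^ (1 + eps))^-1)%:E *
  lne (volume (Gamma := path_graph w0) (path_metric (1 + eps)^-1) 0%N r))%E.
apply: (@le_trans _ _ (ereal_sup [set f x | x in [set r | 1 <= r]])).
  apply: ereal_inf_lbound; exists [set r | 1 <= r] => //.
  exact: nbhs_pinfty_ge.
apply: ge_ereal_sup => _ [r /= r1 <-].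
have r0 : 0 < r by rewrite (lt_le_trans ltr01).
have vol := path_volume w0 e0 (ltW r0).
have rp : 0 < r `^ (1 + eps) by rewrite powR_gt0.
rewrite /f; apply: (@le_trans _ _ (((r `^ (1 + eps))^-1)%:E *
    ((1 + r) `^ (1 + eps))%:E)%E).
  apply: lee_wpmul2l; first by rewrite lee_fin invr_ge0 ltW.
  rewrite -[X in (_ <= X%:E)%E]expRK -lne_EFin ?expR_gt0 //.
  rewrite lee_lne // in_itv /= leey andbT.
    by rewrite /volume /counting; case: ifP => // _; rewrite lee_fin.
  by rewrite lee_fin expR_ge0.
rewrite -EFinM lee_fin ler_pdivrMl // -powRM ?(ltW r0) //.
rewrite ge0_ler_powR ?nnegrE ?(ltW e1) ?addr_ge0 ?mulr_ge0 ?(ltW r0) //.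
by lra.
Qed.

Theorem mainTheorem5 (R : realType) (eps : R) (eps_gt0 : 0 < eps) :
  exists Gamma : weighted_graph R,
    essential_spectrum (laplacian1_domain (Gamma := Gamma))
                       (neg_laplacian1 (Gamma := Gamma)) = set0 /\
    exists rho : Gamma -> Gamma -> R, adapted_metric rho /\
    exists x0 : Gamma,
      (limf_esup
         (fun r : R => ((r `^ (1 + eps))^-1)%:E * lne (volume rho x0 r))
         (pinfty_nbhs R) < +oo)%E.
Proof.
have e1 : 0 < 1 + eps by rewrite addr_gt0.
have b0 : 0 < (1 + eps)^-1 by rewrite invr_gt0.
have b1 : (1 + eps)^-1 < 1 by rewrite invf_lt1 // ltrDl.
have adm := step_admissible b0 b1.
have w0 := weights_gt0 adm.
exists (path_graph w0); split; first exact: path_essential_spectrum adm.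
exists (path_metric (1 + eps)^-1); split; first exact: path_metric_adapted.
by exists 0%N; exact: path_volume_growth.
Qed.
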